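(* Let $\tau\geq\omega_1$ be a cardinal, and let $X$, $Y$, $Z$ and $A(X,Y)$ be the spaces constructed in the context. Then neither $A=Y\times 2$ nor $B=Z\times 2$ is a regular-closed subset of $A(X,Y)$.
   Context: A subset $H$ of a space is regular-closed if it is the closure of an open subset of that space. Write $2=\{0,1\}$. Alexandroff duplicate: for a space $X$, $A(X)$ has underlying set $X\times 2$; each point of $X\times\{1\}$ is isolated, and each point $(x,0)$ has basic open neighborhoods of the form $(U\times 2)\setminus\{(x,1)\}$, where $U$ is an open neighborhood of $x$ in $X$. For $Y\subset X$, $A(X,Y)$ is the set $(X\times\{0\})\cup(Y\times\{1\})$ with the subspace topology from $A(X)$. Construction (Garcia-Ferreira and Ohta): let $\tau^+$ be the first cardinal larger than $\tau$; ordinals carry the order topology. Let $S_1=(\tau^++1)\times(\omega+1)$ and $S_2=(\omega_1+1)\times(\omega+1)$ with the product topologies. Form the quotient of the disjoint union $S_1\oplus S_2$ obtained by identifying, for every $n\in\omega$, the points $(\tau^+,n)\in S_1$ and $(\omega_1,n)\in S_2$, and also identifying $(\tau^+,\omega)\in S_1$ with $(\omega_1,\omega)\in S_2$; let $\varphi$ be the quotient map. Let $X$ be the quotient space minus the point $\varphi((\tau^+,\omega))=\varphi((\omega_1,\omega))$. Let $Y_1=\tau^+\times\{\omega\}\subset S_1$, $Y_2=\omega_1\times\{\omega\}\subset S_2$, $Y=\varphi(Y_1\cup Y_2)$ and $Z=\varphi(Y_2)$. *)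

(* Defs.v *)
From HB Require Import structures.
From mathcomp Require Import all_boot all_order generic_quotient.
From mathcomp Require Import boolp classical_sets functions cardinality.
From mathcomp Require Import set_interval topology wochoice.

Set Implicit Arguments.
Unset Strict Implicit.
Unset Printing Implicit Defensive.

Import Order.TTheory.
Local Open Scope classical_set_scope.
Local Open Scope card_scope.
Local Open Scope quotient_scope.

(* H is the closure of an open set (equivalent to the library's regclosed). *)
Definition regular_closed (T : topologicalType) (H : set T) :=
  exists2 U : set T, open U & H = closure U.

Section Ordinals.
Local Open Scope order_scope.

Definition card_lt T U (A : set T) (B : set U) := (A #<= B) /\ ~ (B #<= A).

(* The successor ordinal a + 1 is represented by a well-ordered type with
   greatest element a; the initial segment below a is then the ordinal a. *)
Definition is_succ_ordinal d (O : orderType d) (a : O) :=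
  well_order (<=%O : rel O) /\ forall b, b <= a.

Definition ordinal_below d (O : orderType d) (a : O) : set O :=
  [set b | b < a].

(* a is the first infinite ordinal. *)
Definition is_omega d (O : orderType d) (a : O) :=
  ~ finite_set (ordinal_below a) /\
  forall b, b < a -> finite_set (ordinal_below b).

(* a is the first ordinal of cardinality larger than that of the type T, that
   is, the first cardinal larger than that of T. *)
Definition is_succ_card (T : Type) d (O : orderType d) (a : O) :=
  card_lt [set: T] (ordinal_below a) /\
  forall b, b < a -> ~ card_lt [set: T] (ordinal_below b).

Definition is_omega1 d (O : orderType d) (a : O) := is_succ_card nat a.

End Ordinals.

Definition alexandroff (X : Type) : Type := (X * bool)%type.

Section AlexandroffDuplicate.
Variable X : topologicalType.

HB.instance Definition _ := Choice.on (alexandroff X).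

Definition alexandroff_basic (x : X) (U : set X) : set (alexandroff X) :=
  (U `*` [set: bool]) `\ (x, true).

(* No condition is imposed at the points (x, true): they are isolated. *)
Definition alexandroff_open (G : set (alexandroff X)) :=
  forall x, G (x, false) ->
    exists U : set X, [/\ open U, U x & alexandroff_basic x U `<=` G].

Lemma alexandroff_openT : alexandroff_open setT.
Proof. by move=> x _; exists setT; split=> //; exact: openT. Qed.

Lemma alexandroff_openI : setI_closed alexandroff_open.
Proof.
move=> G H oG oH x [/oG[U [oU Ux UG]] /oH[V [oV Vx VH]]].
exists (U `&` V); split=> //; first exact: openI.
by move=> p [[[Up Vp] _] px]; split; [exact: UG|exact: VH].
Qed.

Lemma alexandroff_open_bigU (I : Type) (f : I -> set (alexandroff X)) :
  (forall i, alexandroff_open (f i)) -> alexandroff_open (\bigcup_i f i).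
Proof.
move=> of_ x [i _ /of_[U [oU Ux Uf]]].
by exists U; split=> // p /Uf; exists i.
Qed.

HB.instance Definition _ := isOpenTopological.Build (alexandroff X)
  alexandroff_openT alexandroff_openI alexandroff_open_bigU.

Lemma alexandroff_isolated x : open [set ((x, true) : alexandroff X)].
Proof. by move=> y []. Qed.

(* Without T1 the sets alexandroff_basic x U need not be open. *)
Lemma alexandroff_nbhsE x : accessible_space X ->
  nbhs ((x, false) : alexandroff X) =
  filter_from (fun U => open U /\ U x) (alexandroff_basic x).
Proof.
move=> T1; rewrite nbhsE eqEsubset; split=> G /=.
  move=> [H [oH Hx] HG]; have [U [oU Ux UH]] := oH _ Hx.
  by exists U => //; exact: subset_trans HG.
move=> [U [oU Ux] UG]; exists (alexandroff_basic x U) => //; split; last first.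
  by split=> // -[].
move=> y [[/= Uy _] _]; have [->|yx] := eqVneq y x; first by exists U; split.
have [V [oV Vy Vx]] := T1 _ _ yx; move: Vy Vx; rewrite !inE => Vy Vx.
exists (U `&` V); split => //; first exact: openI.
move=> [z b] [[/= [Uz Vz] _] _]; split=> //= -[zx _].
by apply: Vx; rewrite -zx.
Qed.

(* A(X, Y) = (X x {0}) u (Y x {1}), as a subset of A(X). *)
Definition alexandroff_rel_set (Y : set X) : set (alexandroff X) :=
  ([set: X] `*` [set false]) `|` (Y `*` [set true]).

Definition alexandroff_rel (Y : set X) : topologicalType :=
  set_type (alexandroff_rel_set Y).

(* The subset B x 2 of A(X, Y), for B included in Y. *)
Definition times2 (Y B : set X) : set (alexandroff_rel Y) :=
  set_val @^-1` (B `*` [set: bool]).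

End AlexandroffDuplicate.
Arguments times2 {X} Y B.

Section DisjointUnion.
Variables S1 S2 : topologicalType.

Definition summand (i : bool) : topologicalType := if i then S2 else S1.

Definition disjoint_union : topologicalType := {i : bool & summand i}.

Definition dinl (s : S1) : disjoint_union := existT summand false s.
Definition dinr (s : S2) : disjoint_union := existT summand true s.

Lemma dinl_inj : injective dinl.
Proof.
pose f (u : {i & summand i}) : option S1 :=
  let: existT i s := u in
  (if i return summand i -> option S1 then fun=> None else Some) s.
by move=> x y /(congr1 f) [].
Qed.

Lemma dinr_inj : injective dinr.
Proof.
pose f (u : {i & summand i}) : option S2 :=
  let: existT i s := u in
  (if i return summand i -> option S2 then Some else fun=> None) s.
by move=> x y /(congr1 f) [].
Qed.

Lemma dinl_dinr x y : dinl x <> dinr y.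
Proof. by move=> /(congr1 (@projT1 _ _)). Qed.

End DisjointUnion.
Arguments dinl {S1 S2}.
Arguments dinr {S1 S2}.

(* In the intended instance L1 = tau^+ + 1, L2 = omega_1 + 1 and L0 = omega + 1,
   with greatest elements t1, t2 and t0. *)
Section Construction.
Variables (d1 d2 d0 : Order.disp_t).
Variables (L1 : orderTopologicalType d1) (L2 : orderTopologicalType d2).
Variable (L0 : orderTopologicalType d0).
Variables (t1 : L1) (t2 : L2) (t0 : L0).

Definition S1 : topologicalType := (L1 * L0)%type.
Definition S2 : topologicalType := (L2 * L0)%type.
Definition S12 : topologicalType := disjoint_union S1 S2.

(* c ranges over omega + 1: all the n < omega, and omega itself. *)
Definition glued (u v : S12) :=
  exists c : L0, u = dinl ((t1, c) : S1) /\ v = dinr ((t2, c) : S2).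

Definition glue (u v : S12) : bool := `[< [\/ u = v, glued u v | glued v u] >].

Lemma glue_refl : reflexive glue.
Proof. by move=> u; apply/asboolP; constructor 1. Qed.

Lemma glue_sym : symmetric glue.
Proof.
have imp u v : glue u v -> glue v u.
  by move=> /asboolP[->|?|?]; apply/asboolP;
    [constructor 1|constructor 3|constructor 2].
by move=> u v; apply/idP/idP; exact: imp.
Qed.

Lemma glue_trans : transitive glue.
Proof.
move=> v u w /asboolP[->//|uv|vu] /asboolP[<-|vw|wv]; apply/asboolP.
- by constructor 2.
- by case: uv vw => [c [_ ->]] [e [/esym/dinl_dinr]].
- case: uv wv => [c [-> ->]] [e [-> /dinr_inj [->]]]; by constructor 1.
- by constructor 3.
- case: vu vw => [c [-> ->]] [e [/dinl_inj [->] ->]]; by constructor 1.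
- by case: vu wv => [c [-> _]] [e [_ /dinl_dinr]].
Qed.

Canonical glue_equiv := EquivRel glue glue_refl glue_sym glue_trans.

Definition glueing : topologicalType := quotient_topology {eq_quot glue_equiv}.

Definition phi (u : S12) : glueing :=
  \pi_(quotient_topology {eq_quot glue_equiv}) u.

Definition spaceX : topologicalType :=
  set_type (~` [set phi (dinl ((t1, t0) : S1))]).

Definition Y1 : set S1 := ordinal_below t1 `*` [set t0].
Definition Y2 : set S2 := ordinal_below t2 `*` [set t0].

(* The subsets phi (Y1 u Y2) and phi (Y2) of the glueing miss the removed point;
   they are taken here as subsets of spaceX. *)
Definition subY : set spaceX :=
  set_val @^-1` (phi @` ((dinl @` Y1) `|` (dinr @` Y2))).
Definition subZ : set spaceX := set_val @^-1` (phi @` (dinr @` Y2)).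

End Construction.
Arguments subY {d1 d2 d0 L1 L2 L0} t1 t2 t0.
Arguments subZ {d1 d2 d0 L1 L2 L0} t1 t2 t0.

(* Main.v *)
Require Import Defs.
From mathcomp Require Import all_boot all_order.
From mathcomp Require Import classical_sets cardinality topology.
From mathcomp Require Import generic_quotient interval boolp functions.
From mathcomp Require Import set_interval wochoice.

(** Let p = phi (0, omega), with (0, omega) in S_2; it is in Z because
0 < omega_1.  As 0 is isolated in omega_1 + 1, the set phi ({0} x (omega + 1))
is open, and it meets Y only in p.  As omega is a limit ordinal, p is
nevertheless a limit of the points phi (0, n), which lie outside Y, so p is not
interior to Y ([subY_limit]).

Such a point prevents W x 2 from being regular-closed, for W = Y as well as for
W = Z ([times2_not_regular_closed]).  Indeed, let W x 2 be the closure of an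
open set U.  The point (p, 0) has a neighbourhood that avoids (p, 1) and lies
over an open set meeting W only in p, so U, which is included in W x 2, can meet
this neighbourhood only in (p, 0) itself.  Hence (p, 0) is in U; since U is
open, the points (x, 0) with x near p are in U, so that a neighbourhood of p
lies in W.  This makes p interior to W, a contradiction. *)

Import Order.TTheory.
Local Open Scope classical_set_scope.
Local Open Scope card_scope.

(** * Obstruction to regular-closedness in the Alexandroff duplicate *)

(** Closedness of the point p makes removing (p, 1) from N x 2 an open
operation: over another point of N, the neighbourhoods have to be shrunk to
miss p. *)
Lemma open_setX2D1 (X : topologicalType) (p : X) (N : set X) :
  closed [set p] -> open N ->
  @open (alexandroff X) ((N `*` [set: bool]) `\ (p, true)).
Proof.
move=> clp oN.
suff: alexandroff_open ((N `*` [set: bool]) `\ (p, true)) by [].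
move=> x [[/= Nx _] _].
have [xp|/eqP xp] := eqVneq x p; first by exists N; split=> //; rewrite xp.
exists (N `\ p); split=> //.
  by rewrite setDE; apply: openI => //; exact: closed_openC.
by move=> [z b] [[/= [Nz zp] _] _]; split=> // -[].
Qed.

(** An open U with closure W x 2 must reach (p, 0), but near (p, 0) the set
W x 2 consists of (p, 0) and (p, 1) only, and (p, 1) can be avoided. *)
Lemma times2_not_regular_closed (X : topologicalType) (Y W : set X) (p : X) :
    W p -> closed [set p] ->
    (exists2 N, open N & N p /\ N `&` W `<=` [set p]) ->
    (forall V, open V -> V p -> ~ V `<=` W) ->
  ~ regular_closed (times2 Y W).
Proof.
move=> Wp clp [N oN [Np NW]] intW [U oU WU].
have UW : U `<=` times2 Y W by rewrite WU; exact: subset_closure.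
have AXY0 x : alexandroff_rel_set Y (x, false) by left.
pose p0 : alexandroff_rel Y := exist _ (p, false) (mem_set (AXY0 p)).
pose G : set (alexandroff_rel Y) :=
  set_val @^-1` ((N `*` [set: bool]) `\ (p, true)).
have oG : open G by exists ((N `*` [set: bool]) `\ (p, true)) => //;
  exact: open_setX2D1.
have Up0 : U p0.
  have : closure U p0 by rewrite -WU.
  have nG : nbhs p0 G by apply: open_nbhs_nbhs; split.
  move=> /(_ _ nG) [[[x b] AXYq] [Uq]].
  rewrite /G /= set_valE /= => -[[Nx _] q1].
  have [Wx _] := UW _ Uq; rewrite set_valE /= in Wx.
  have xp : x = p by apply: NW.
  case: b AXYq Uq q1 => AXYq Uq q1; first by case: q1; rewrite xp.
  suff -> : p0 = exist _ (x, false) AXYq by [].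
  by apply: val_inj; rewrite /= xp.
case: oU => U' oU' U'U.
have [V [oV Vp VU']] : exists V : set X,
    [/\ open V, V p & alexandroff_basic p V `<=` U'].
  by apply: oU'; move: Up0; rewrite -U'U.
apply: (intW V oV Vp) => x Vx.
have /UW [] // : U (exist _ (x, false) (mem_set (AXY0 x)) : alexandroff_rel Y).
by rewrite -U'U; apply: VU'; split=> // -[].
Qed.

(** * The least element and the first infinite ordinal *)

Lemma well_order_min d (O : orderType d) (A : set O) :
  well_order (<=%O : rel O) -> A !=set0 ->
  exists2 m, A m & forall x, A x -> (m <= x)%O.
Proof.
move=> wo [x Ax].
have [|m [[mA mP] _]] := wo (mem A); first by exists x; rewrite inE.
exists m; first by rewrite inE in mA.
by move=> y Ay; apply: mP; rewrite inE.
Qed.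

(** The least element is isolated because it has a successor s, so that its
singleton is the open ray of the elements below s. *)
Lemma isolated_bottom d (O : orderTopologicalType d) (a : O) :
  well_order (<=%O : rel O) -> ordinal_below a !=set0 ->
  exists m : O, (m < a)%O /\ open [set m].
Proof.
move=> wo [b ba].
have [m _ mP] := well_order_min _ _ setT wo (ex_intro _ b I).
have ma : (m < a)%O by apply: le_lt_trans ba; exact: mP.
have [s /= ms sP] := well_order_min _ _ [set x | (m < x)%O] wo
  (ex_intro _ a ma).
exists m; split=> //.
suff -> : [set m] = [set` `]-oo, s[%O] by exact: lray_open.
apply/seteqP; split=> x /=; rewrite in_itv /=; first by move=> ->.
move=> xs; apply/eqP; rewrite eq_le mP // andbT leNgt.
by apply/negP => /sP; rewrite leNgt xs.
Qed.

(** omega is a limit: if V contained no ordinal below it, these ordinals would be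
those below some b < omega together with b, a finite set. *)
Lemma nbhs_omega d (O : orderTopologicalType d) (a : O) (V : set O) :
  is_omega a -> nbhs a V -> exists2 c, (c < a)%O & V c.
Proof.
move=> [infa fina]; rewrite itv_nbhsE => -[[l r] [oi ai] iV].
move: ai; rewrite itv_boundlr => /andP[la ar].
apply: contrapT => noc; apply: infa.
have ltl c : (c < a)%O -> (BLeft c < l)%O.
  move=> ca; rewrite ltNge; apply/negP => lc; apply: noc; exists c => //.
  apply: iV; rewrite /= itv_boundlr lc; apply: le_trans ar.
  by rewrite bnd_simp ltW.
case: l oi la ltl {iV} => [lb b|[]] oi la ltl //; last first.
  by apply: sub_finite_set (finite_set0 _) => c /ltl.
(* A left end b is open, so b < a; all that is below a is then at most b. *)
have lbE := itv_open_ends_lside oi; rewrite lbE bnd_simp in la ltl.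
apply: (@sub_finite_set _ _ (ordinal_below b `|` [set b])).
  move=> c /ltl; rewrite bnd_simp le_eqVlt => /orP[/eqP ->|cb]; first by right.
  by left.
by rewrite finite_setU; split; [exact: fina|exact: finite_set1].
Qed.

(** * The glued space *)

(** Only points of S2 with first coordinate t2 are glued, so that (a, c) is
alone in its class. *)
Lemma phi_dinr_inj {d1 d2 d0} {L1 : orderTopologicalType d1}
    {L2 : orderTopologicalType d2} {L0 : orderTopologicalType d0}
    {t1 : L1} {t2 : L2} (u : S12 L1 L2 L0) (a : L2) (c : L0) :
  a <> t2 -> phi t1 t2 u = phi t1 t2 (dinr ((a, c) : S2 L2 L0)) ->
  u = dinr ((a, c) : S2 L2 L0).
Proof.
move=> at2 uac.
have /eqmodP /asboolP : (u = dinr ((a, c) : S2 L2 L0)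
  %[mod {eq_quot (@glue_equiv _ _ _ L1 L2 L0 t1 t2)}])%qT by exact: uac.
case=> [//|[e [_ ac]]|[e [/esym ac _]]].
  by move: ac => /dinr_inj [].
by case: (dinl_dinr ac).
Qed.

Lemma ex_phi_dinr {d1 d2 d0} {L1 : orderTopologicalType d1}
    {L2 : orderTopologicalType d2} {L0 : orderTopologicalType d0}
    (t1 : L1) (t2 : L2) (t0 : L0) (a : L2) (c : L0) :
  a <> t2 ->
  exists x : spaceX t1 t2 t0, set_val x = phi t1 t2 (dinr ((a, c) : S2 L2 L0)).
Proof.
move=> at2.
have xP : (~` [set phi t1 t2 (dinl ((t1, t0) : S1 L1 L0))])
    (phi t1 t2 (dinr ((a, c) : S2 L2 L0))).
  by move=> /esym /(phi_dinr_inj _ _ _ at2) /dinl_dinr.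
by exists (exist (fun x => x \in ~` _) _ (mem_set xP)); rewrite set_valE.
Qed.

(** The column over m is open in S2 and, missing the glued edge, saturated. *)
Lemma open_phi_dinr {d1 d2 d0} {L1 : orderTopologicalType d1}
    {L2 : orderTopologicalType d2} {L0 : orderTopologicalType d0}
    {t1 : L1} {t2 : L2} (m : L2) :
  open [set m] -> m <> t2 ->
  open (phi t1 t2 @` (dinr @` ([set m] `*` [set: L0] : set (S2 L2 L0)))).
Proof.
move=> om mt2; set D := dinr @` _.
have oD : open D.
  apply: (@existT_open_map _ (summand (S1 L1 L0) (S2 L2 L0)) true).
  have -> : [set m] `*` [set: L0] = fst @^-1` [set m] by rewrite setXT.
  by apply: open_comp => // x _; exact: cvg_fst.
suff E : phi t1 t2 @^-1` (phi t1 t2 @` D) = D.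
  by suff : open (phi t1 t2 @^-1` (phi t1 t2 @` D)) by []; rewrite E.
apply/seteqP; split=> u; last by move=> Du; exists u.
by move=> [_ [[a c] [/= -> _] <-]] /esym /(phi_dinr_inj _ _ _ mt2) ->;
  exists (m, c).
Qed.

Lemma closed1_order d (O : orderTopologicalType d) (x : O) : closed [set x].
Proof.
exact: accessible_closed_set1 (hausdorff_accessible order_hausdorff) x.
Qed.

Lemma closed_phi_dinr {d1 d2 d0} {L1 : orderTopologicalType d1}
    {L2 : orderTopologicalType d2} {L0 : orderTopologicalType d0}
    {t1 : L1} {t2 : L2} (m : L2) (c : L0) :
  m <> t2 -> closed [set phi t1 t2 (dinr ((m, c) : S2 L2 L0))].
Proof.
move=> mt2; rewrite -openC.
suff : open (phi t1 t2 @^-1` ~` [set phi t1 t2 (dinr ((m, c) : S2 L2 L0))])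
  by [].
apply/sigT_openP => -[].
  suff -> : existT (summand (S1 L1 L0) (S2 L2 L0)) true @^-1`
      (phi t1 t2 @^-1` ~` [set phi t1 t2 (dinr ((m, c) : S2 L2 L0))])
    = fst @^-1` (~` [set m]) `|` snd @^-1` (~` [set c]).
    by apply: openU; apply: open_comp => [x _|];
      [exact: cvg_fst|exact/closed_openC/closed1_order
      |exact: cvg_snd|exact/closed_openC/closed1_order].
  apply/seteqP; split=> -[a e] /= ne.
    apply: contrapT => /not_orP[/contrapT am /contrapT ec].
    by apply: ne; rewrite am ec.
  by move/(phi_dinr_inj _ _ _ mt2)/dinr_inj => [am ec]; case: ne.
suff -> : existT (summand (S1 L1 L0) (S2 L2 L0)) false @^-1`
    (phi t1 t2 @^-1` ~` [set phi t1 t2 (dinr ((m, c) : S2 L2 L0))]) = setT.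
  exact: openT.
by apply/seteqP; split=> // u _ /(phi_dinr_inj _ _ _ mt2)/dinl_dinr.
Qed.

(** The points phi (m, n) with n < t0 are outside Y and converge to
phi (m, t0). *)
Lemma subY_limit {d1 d2 d0} {L1 : orderTopologicalType d1}
    {L2 : orderTopologicalType d2} {L0 : orderTopologicalType d0}
    {t1 : L1} {t2 : L2} (t0 : L0) (m : L2)
    (V : set (spaceX t1 t2 t0)) (p : spaceX t1 t2 t0) :
  is_omega t0 -> m <> t2 ->
  set_val p = phi t1 t2 (dinr ((m, t0) : S2 L2 L0)) ->
  open V -> V p -> ~ V `<=` subY t1 t2 t0.
Proof.
move=> omegaP mt2 pE [V' oV' V'V] Vp VY.
have V'p : V' (phi t1 t2 (dinr ((m, t0) : S2 L2 L0))).
  by rewrite -pE; move: Vp; rewrite -V'V.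
have [c ct0 V'c] : exists2 c, (c < t0)%O &
    V' (phi t1 t2 (dinr ((m, c) : S2 L2 L0))).
  apply: nbhs_omega omegaP _.
  have /sigT_openP/(_ true) oW : @open (S12 L1 L2 L0) (phi t1 t2 @^-1` V')
    by exact: oV'.
  have nW : nbhs ((m, t0) : S2 L2 L0)
      (existT (summand (S1 L1 L0) (S2 L2 L0)) true @^-1` (phi t1 t2 @^-1` V')).
    by apply: open_nbhs_nbhs; split.
  have cm : (fun e : L0 => (m, e)) @ t0 --> (m, t0).
    exact: cvg_pair (cvg_cst m) cvg_id.
  exact: cm _ nW.
have [x xE] := ex_phi_dinr t1 t2 t0 m c mt2.
have : subY t1 t2 t0 x by apply: VY; rewrite -V'V /= xE.
rewrite /subY /= xE => -[u Yu /(phi_dinr_inj _ _ _ mt2) uE].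
move: Yu; rewrite uE.
move=> -[[s _ /dinl_dinr//]|[[a e] [_ /= ->] /dinr_inj [_ et0]]].
by move: ct0; rewrite -et0 ltxx.
Qed.

Theorem mainTheorem2 (tau : Type) (d1 d2 d0 : Order.disp_t)
    (L1 : orderTopologicalType d1) (L2 : orderTopologicalType d2)
    (L0 : orderTopologicalType d0)
    (tau_plus : L1) (omega1 : L2) (omega : L0)
    (tau_plus_succ : is_succ_ordinal tau_plus)
    (omega1_succ : is_succ_ordinal omega1)
    (omega_succ : is_succ_ordinal omega)
    (tau_plusP : is_succ_card tau tau_plus)
    (omega1P : is_omega1 omega1)
    (omegaP : is_omega omega)
    (le_omega1_tau : ordinal_below omega1 #<= [set: tau]) :
  let Y := subY tau_plus omega1 omega in
  let Z := subZ tau_plus omega1 omega in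
  ~ regular_closed (times2 Y Y) /\ ~ regular_closed (times2 Y Z).
Proof.
move=> Y Z.
have [m [momega1 om]] : exists m : L2, (m < omega1)%O /\ open [set m].
  apply: isolated_bottom omega1_succ.1 _; apply/set0P/eqP => omega1_0.
  by case: omega1P => -[_ nle] _; apply: nle; rewrite omega1_0; exact: card_ge0.
have mNomega1 : m <> omega1 by apply/eqP; rewrite lt_eqF.
have [p pE] := ex_phi_dinr tau_plus omega1 omega m omega mNomega1.
have ZY : Z `<=` Y by move=> x [u Zu ux]; exists u => //; right.
have Zp : Z p.
  rewrite /Z /subZ /= pE.
  by exists (dinr ((m, omega) : S2 L2 L0)) => //; exists (m, omega).
have clp : closed [set p].
  have -> : [set p] = set_val @^-1` [set set_val p].
    by apply/seteqP; split=> x /= => [->//|/val_inj].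
  rewrite pE; apply: preimage_closed (closed_phi_dinr _ _ mNomega1) => x _.
  exact: initial_continuous.
have [N oN [Np NY]] : exists2 N, open N & N p /\ N `&` Y `<=` [set p].
  exists (set_val @^-1` (phi tau_plus omega1 @`
      (dinr @` ([set m] `*` [set: L0] : set (S2 L2 L0))))).
    by eexists; [exact: open_phi_dinr om mNomega1|].
  split.
    rewrite /= pE; exists (dinr ((m, omega) : S2 L2 L0)) => //.
    by exists (m, omega).
  move=> q [/= [_ [[_ c] [/= -> _] <-] cq]] [u Yu uq].
  have uE : u = dinr ((m, c) : S2 L2 L0).
    by apply: (phi_dinr_inj _ _ _ mNomega1); exact: etrans uq (esym cq).
  suff cE : c = omega by apply: val_inj; rewrite -set_valE -cq pE cE.
  move: Yu; rewrite uE.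
  by move=> -[[s _ /dinl_dinr//]|[[a e] [_ /= ->] /dinr_inj []]].
have intY V : open V -> V p -> ~ V `<=` Y.
  exact: subY_limit omegaP mNomega1 _.
split; apply: (times2_not_regular_closed _ _ _ p) => //.
- exact: ZY.
- by exists N.
- by exists N => //; split=> // q [Nq /ZY Yq]; exact: NY.
- by move=> V oV Vp VZ; apply: (intY V oV Vp) => x /VZ/ZY.
Qed.
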